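(* Let $(X,d)$ be a metric space and $p\ge1$. Then $\sqrt{H_p}$ is a metric on the cone $\mathfrak{C}$ over $X$, where $H_p$ is the marginal perspective cost induced by the entropy $U_p$ and the cost $c=d^2$, explicitly $$H_p(x_1,r;x_2,t)=\frac{2}{p}\Big[\mathfrak{M}_1(r,t)-\mathfrak{M}_{1-p}(r,t)\Big(1-(p-1)\frac{d^2(x_1,x_2)}{2}\Big)_+^{\frac{p}{p-1}}\Big]\quad(p>1),$$ $$H_1(x_1,r;x_2,t)=2\Big[\mathfrak{M}_1(r,t)-\mathfrak{M}_0(r,t)e^{-d^2(x_1,x_2)/2}\Big].$$ That is: $H_p(x_1,r;x_2,t)$ depends only on the equivalence classes of $(x_1,r)$ and $(x_2,t)$ in $\mathfrak C$, it vanishes iff these classes coincide, it is symmetric, and $\sqrt{H_p(x_1,r;x_3,t)}\le\sqrt{H_p(x_1,r;x_2,s)}+\sqrt{H_p(x_2,s;x_3,t)}$ for all $x_1,x_2,x_3\in X$, $r,s,t\ge0$.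
   Context: Power means: for $r,t\ge0$ and $q\neq0$, $\mathfrak{M}_q(r,t)=\big(\frac{r^q+t^q}{2}\big)^{1/q}$, except $\mathfrak{M}_q(r,t)=0$ when $q<0$ and $r=0$ or $t=0$; $\mathfrak{M}_0(r,t)=\sqrt{rt}$. $(y)_+=\max(y,0)$. Power-like entropy: $U_p(s)=\frac{1}{p(p-1)}(s^p-p(s-1)-1)$ for $p\neq0,1$, $U_1(s)=s\ln s-s+1$. The induced marginal perspective cost is $H(x_1,r_1;x_2,r_2)=H_{c(x_1,x_2)}(r_1,r_2)$ where $H_c$ is the lower semicontinuous envelope of $(r_1,r_2)\mapsto\inf_{\theta>0}[r_1F(\theta/r_1)+r_2F(\theta/r_2)+\theta c]$ (with the perspective convention at $r_i=0$); for $F=U_p$, $c=d^2$ it equals the displayed formulas. The cone over $X$ is $\mathfrak C=(X\times[0,\infty))/\sim$ with $(x_1,r_1)\sim(x_2,r_2)$ iff $r_1=r_2=0$, or $r_1=r_2$ and $x_1=x_2$. *)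

(* Defs.v *)
From Stdlib Require Import Reals.
Open Scope R_scope.

Definition is_metric {X : Type} (d : X -> X -> R) : Prop :=
  (forall x y, 0 <= d x y) /\
  (forall x y, d x y = 0 <-> x = y) /\
  (forall x y, d x y = d y x) /\
  (forall x y z, d x z <= d x y + d y z).

(* x^y for x >= 0 and y > 0, with the convention 0^y = 0. *)
Definition rpow (x y : R) : R :=
  if Rle_dec x 0 then 0 else Rpower x y.

Definition power_mean (q r t : R) : R :=
  if Req_EM_T q 0 then sqrt (r * t)
  else if Rlt_dec q 0 then
    (if Req_EM_T r 0 then 0
     else if Req_EM_T t 0 then 0
     else Rpower ((Rpower r q + Rpower t q) / 2) (1 / q))
  else rpow ((rpow r q + rpow t q) / 2) (1 / q).

Definition pos_part (y : R) : R := Rmax y 0.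

Definition Hp {X : Type} (d : X -> X -> R) (p : R)
    (x1 : X) (r : R) (x2 : X) (t : R) : R :=
  if Req_EM_T p 1 then
    2 * (power_mean 1 r t - power_mean 0 r t * exp (- (d x1 x2)^2 / 2))
  else
    (2 / p) * (power_mean 1 r t
      - power_mean (1 - p) r t
        * rpow (pos_part (1 - (p - 1) * (d x1 x2)^2 / 2)) (p / (p - 1))).

Definition cone_eq {X : Type} (x1 : X) (r1 : R) (x2 : X) (r2 : R) : Prop :=
  (r1 = 0 /\ r2 = 0) \/ (r1 = r2 /\ x1 = x2).

(* Main.v *)
Require Import Defs.
From Stdlib Require Import Reals.
From Stdlib Require Import Lra Psatz.
Open Scope R_scope.

(** Up to the factor [1/p], the cost between masses [r], [t] at distance [d] is the minimum
    over [th > 0] of [G(r,th) + G(t,th) + p th d^2], where [G(r,th) = p r U_p(th/r) >= 0],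
    and the triangle inequality for the square root amounts to
    [l m H13 <= m H12 + l H23] for all weights [l + m = 1].  If [th1], [th2] are optimal for
    the two costs on the right, let [sg] be their [p]-power mean with weights [m], [l], and
    use [th1 th2 / sg] as a competitor on the left.  With [mu = m th1 + l th2 <= sg], the
    difference of the [G]-parts is then exactly
    [m^2 G(r,th1^2/sg) + l^2 G(t,th2^2/sg) + G(s,sg) + p/(p-1) (mu - sg)^2 / sg]
    (without the last term when [p = 1]), and [mu <= sg] is what Cauchy-Schwarz needs to
    compare the distance parts.  If [H12] or [H23] has no coupling term, the minimum need not
    be attained, but the Hellinger bound [(sqrt r - sqrt t)^2 <= p H] suffices. *)

(** * Convexity inequalities for the exponential, real powers and the logarithm *)

(** The tangent of [exp] at [c * x] is evaluated at [x] and at [0]; averaging with weights [c] and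
    [1 - c] cancels the slope terms. *)
Lemma exp_convex_chord (c x : R) : 0 <= c <= 1 -> exp (c * x) <= c * exp x + (1 - c).
Proof.
  intros Hc.
  assert (Hz := exp_pos (c * x)).
  assert (H1 : exp (c * x) * (1 + (x - c * x)) <= exp x).
  { replace (exp x) with (exp (c * x) * exp (x - c * x))
      by (rewrite <- exp_plus; f_equal; ring).
    apply Rmult_le_compat_l; [lra | apply exp_ineq1_le]. }
  assert (H2 : exp (c * x) * (1 - c * x) <= 1).
  { replace 1 with (exp (c * x) * exp (- (c * x))) at 2
      by (rewrite <- exp_plus, <- exp_0; f_equal; ring).
    apply Rmult_le_compat_l; [lra |].
    assert (H := exp_ineq1_le (- (c * x))); lra. }
  assert (H3 : c * (exp (c * x) * (1 + (x - c * x))) <= c * exp x)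
    by (apply Rmult_le_compat_l; lra).
  assert (H4 : (1 - c) * (exp (c * x) * (1 - c * x)) <= (1 - c) * 1)
    by (apply Rmult_le_compat_l; lra).
  lra.
Qed.

Lemma Rpower_pos (x y : R) : 0 < Rpower x y.
Proof. apply exp_pos. Qed.

(** Chord inequality at [p * ln u] with weight [/ p], multiplied by [p]. *)
Lemma Rpower_bernoulli (u p : R) : 1 <= p -> 0 < u -> 1 + p * (u - 1) <= Rpower u p.
Proof.
  intros Hp Hu.
  assert (Hip : 0 <= / p <= 1).
  { split; [left; apply Rinv_0_lt_compat; lra |].
    rewrite <- Rinv_1; apply Rinv_le_contravar; lra. }
  assert (H := exp_convex_chord (/ p) (p * ln u) Hip).
  replace (/ p * (p * ln u)) with (ln u) in H by (field; lra).
  rewrite exp_ln in H by assumption.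
  fold (Rpower u p) in H.
  apply (Rmult_le_compat_l p) in H; [| lra].
  replace (p * (/ p * Rpower u p + (1 - / p))) with (Rpower u p + (p - 1)) in H
    by (field; lra).
  lra.
Qed.

(** Bernoulli at [x / y], scaled by [y^p]: the power function lies above its tangent at [y]. All
    convexity arguments for [p > 1] below rest on this form. *)
Lemma Rpower_tangent (x y p : R) :
  1 <= p -> 0 < x -> 0 < y -> Rpower y p * (1 + p * (x / y - 1)) <= Rpower x p.
Proof.
  intros Hp Hx Hy.
  assert (Hxy : 0 < x / y) by (apply Rdiv_lt_0_compat; assumption).
  replace (Rpower x p) with (Rpower y p * Rpower (x / y) p).
  - apply Rmult_le_compat_l; [left; apply Rpower_pos | now apply Rpower_bernoulli].
  - rewrite Rpower_mult_distr by assumption; f_equal; field; lra.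
Qed.

Lemma Rpower_split (x p : R) : 0 < x -> Rpower x p * Rpower x (1 - p) = x.
Proof.
  intros Hx; rewrite <- Rpower_plus.
  replace (p + (1 - p)) with 1 by ring; now apply Rpower_1.
Qed.

(** The entropy counterpart of the tangent bound for [p = 1], from [exp u >= 1 + u] at
    [u = - ln (x / y)]. *)
Lemma ln_div_lower (x y : R) : 0 < x -> 0 < y -> x - y <= x * ln (x / y).
Proof.
  intros Hx Hy.
  assert (Hxy : 0 < x / y) by (apply Rdiv_lt_0_compat; assumption).
  assert (H := exp_ineq1_le (- ln (x / y))).
  rewrite exp_Ropp, exp_ln in H by assumption.
  apply (Rmult_le_compat_l x) in H; [| lra].
  replace (x * / (x / y)) with y in H by (field; lra).
  lra.
Qed.

(** * Perspective terms and the merging of two competitors *)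

(* [marg p r th] is the paper's perspective term [p r U_p(th / r)]. *)
Definition marg (p r th : R) : R :=
  if Req_EM_T p 1 then th * ln (th / r) - th + r
  else r - p / (p - 1) * th + Rpower th p * Rpower r (1 - p) / (p - 1).

Lemma marg_1 (r th : R) : marg 1 r th = th * ln (th / r) - th + r.
Proof. unfold marg; destruct (Req_EM_T 1 1); [reflexivity | lra]. Qed.

Lemma marg_gt1 (p r th : R) : 1 < p ->
  marg p r th = r - p / (p - 1) * th + Rpower th p * Rpower r (1 - p) / (p - 1).
Proof. intros Hp; unfold marg; destruct (Req_EM_T p 1); [lra | reflexivity]. Qed.

Lemma marg_nonneg (p r th : R) : 1 <= p -> 0 < r -> 0 < th -> 0 <= marg p r th.
Proof.
  intros [Hp | <-] Hr Hth.
  - rewrite marg_gt1 by assumption.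
    assert (H := Rpower_tangent th r p (Rlt_le _ _ Hp) Hth Hr).
    apply (Rmult_le_compat_r (Rpower r (1 - p))) in H; [| left; apply Rpower_pos].
    replace (Rpower r p * (1 + p * (th / r - 1)) * Rpower r (1 - p))
      with (Rpower r p * Rpower r (1 - p) * (1 + p * (th / r - 1))) in H by ring.
    rewrite Rpower_split in H by assumption.
    replace (r * (1 + p * (th / r - 1))) with (r + p * th - p * r) in H by (field; lra).
    replace (r - p / (p - 1) * th + Rpower th p * Rpower r (1 - p) / (p - 1))
      with ((Rpower th p * Rpower r (1 - p) - (r + p * th - p * r)) / (p - 1))
      by (field; lra).
    apply Rmult_le_pos; [lra | left; apply Rinv_0_lt_compat; lra].
  - rewrite marg_1.
    assert (H := ln_div_lower th r Hth Hr); lra.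
Qed.

(** Jensen's inequality: the tangents of the power at [sg], taken at [a] and [b] and averaged, stay
    below [sg^p], which forces the arithmetic mean below [sg]. *)
Lemma weighted_power_mean (p l a b sg : R) :
  1 <= p -> 0 < l < 1 -> 0 < a -> 0 < b -> 0 < sg ->
  Rpower sg p = (1 - l) * Rpower a p + l * Rpower b p ->
  (1 - l) * a + l * b <= sg.
Proof.
  intros Hp Hl Ha Hb Hsg Hpow.
  assert (Ta := Rpower_tangent a sg p Hp Ha Hsg).
  assert (Tb := Rpower_tangent b sg p Hp Hb Hsg).
  assert (Hs := Rpower_pos sg p).
  assert (H : Rpower sg p * (p * (((1 - l) * a + l * b) / sg - 1)) <= 0).
  { replace (Rpower sg p * (p * (((1 - l) * a + l * b) / sg - 1)))
      with ((1 - l) * (Rpower sg p * (1 + p * (a / sg - 1)))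
            + l * (Rpower sg p * (1 + p * (b / sg - 1))) - Rpower sg p)
      by (field; lra).
    rewrite Hpow at 3.
    nra. }
  apply Rnot_lt_le; intros Hlt.
  assert (0 < Rpower sg p * (p * (((1 - l) * a + l * b) / sg - 1))); [| lra].
  apply Rmult_lt_0_compat; [assumption |].
  apply Rmult_lt_0_compat; [lra |].
  replace (((1 - l) * a + l * b) / sg - 1) with (((1 - l) * a + l * b - sg) / sg)
    by (field; lra).
  apply Rdiv_lt_0_compat; lra.
Qed.

Lemma Rpower_mul_div (a b sg p : R) :
  0 < a -> 0 < b -> 0 < sg ->
  Rpower (a * b / sg) p = Rpower a p * Rpower b p / Rpower sg p.
Proof.
  intros Ha Hb Hsg.
  apply (Rmult_eq_reg_r (Rpower sg p)); [| apply Rgt_not_eq, Rpower_pos].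
  rewrite Rpower_mult_distr; [| apply Rdiv_lt_0_compat; [now apply Rmult_lt_0_compat |] | ]; try assumption.
  replace (a * b / sg * sg) with (a * b) by (field; lra).
  rewrite <- Rpower_mult_distr by assumption.
  field; apply Rgt_not_eq, Rpower_pos.
Qed.

(** The algebra behind the identity: if [S = (1 - l) * A + l * B], then [l * (1 - l) * A * B / S =
    (1 - l) * A - (1 - l)^2 * A^2 / S], and likewise for [B]. With [A = th1^p], [B = th2^p] one has
    [S = sg^p], so the power terms match exactly; in the linear terms [sg] replaces the arithmetic
    mean, which leaves the square. *)
Lemma marg_merge (p l r s t th1 th2 : R) :
  1 <= p -> 0 < l < 1 -> 0 < r -> 0 < s -> 0 < t -> 0 < th1 -> 0 < th2 ->
  exists th, 0 < th /\
    th * ((1 - l) * th1 + l * th2) <= th1 * th2 /\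
    l * (1 - l) * (marg p r th + marg p t th)
      <= (1 - l) * (marg p r th1 + marg p s th1) + l * (marg p s th2 + marg p t th2).
Proof.
  intros Hp Hl Hr Hs Ht H1 H2.
  assert (HA := Rpower_pos th1 p); assert (HB := Rpower_pos th2 p).
  set (sg := Rpower ((1 - l) * Rpower th1 p + l * Rpower th2 p) (/ p)).
  assert (Hsg : 0 < sg) by apply Rpower_pos.
  assert (HS : Rpower sg p = (1 - l) * Rpower th1 p + l * Rpower th2 p).
  { unfold sg; rewrite Rpower_mult, Rinv_l by lra; apply Rpower_1; nra. }
  assert (Hm := weighted_power_mean p l th1 th2 sg Hp Hl H1 H2 Hsg HS).
  assert (Hz1 : 0 < th1 * th1 / sg) by (apply Rdiv_lt_0_compat; nra).
  assert (Hz2 : 0 < th2 * th2 / sg) by (apply Rdiv_lt_0_compat; nra).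
  assert (Hth : 0 < th1 * th2 / sg) by (apply Rdiv_lt_0_compat; nra).
  exists (th1 * th2 / sg); split; [assumption | split].
  { apply Rmult_le_reg_r with sg; [assumption |].
    replace (th1 * th2 / sg * ((1 - l) * th1 + l * th2) * sg)
      with (th1 * th2 * ((1 - l) * th1 + l * th2)) by (field; lra).
    apply Rmult_le_compat_l; nra. }
  assert (Gr := marg_nonneg p r _ Hp Hr Hz1).
  assert (Gt := marg_nonneg p t _ Hp Ht Hz2).
  assert (Gs := marg_nonneg p s _ Hp Hs Hsg).
  apply (Rmult_le_compat_l ((1 - l) * (1 - l))) in Gr; [| nra].
  apply (Rmult_le_compat_l (l * l)) in Gt; [| nra].
  destruct Hp as [Hp | <-].
  - assert (Hsq : 0 <= p / (p - 1) * (((1 - l) * th1 + l * th2 - sg) ^ 2 / sg)).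
    { apply Rmult_le_pos; [| apply Rmult_le_pos].
      - apply Rmult_le_pos; [lra | left; apply Rinv_0_lt_compat; lra].
      - apply pow2_ge_0.
      - left; apply Rinv_0_lt_compat; lra. }
    rewrite !marg_gt1 in * by assumption.
    rewrite !Rpower_mul_div, HS in * by assumption.
    apply Rminus_le.
    (* The difference of the two sides is minus the three nonnegative terms [Gr], [Gt], [Gs] and the
       square [Hsq]. *)
    match goal with |- ?x <= 0 => replace x with
      (- ((1 - l) * (1 - l) * (r - p / (p - 1) * (th1 * th1 / sg) +
         Rpower th1 p * Rpower th1 p / ((1 - l) * Rpower th1 p + l * Rpower th2 p)
           * Rpower r (1 - p) / (p - 1)))
       - l * l * (t - p / (p - 1) * (th2 * th2 / sg) +
         Rpower th2 p * Rpower th2 p / ((1 - l) * Rpower th1 p + l * Rpower th2 p)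
           * Rpower t (1 - p) / (p - 1))
       - (s - p / (p - 1) * sg +
          ((1 - l) * Rpower th1 p + l * Rpower th2 p) * Rpower s (1 - p) / (p - 1))
       - p / (p - 1) * (((1 - l) * th1 + l * th2 - sg) ^ 2 / sg)) end.
    + lra.
    + field; repeat split; try lra; nra.
  (* For [p = 1], [sg] is the arithmetic mean itself and no square remains; once the logarithms are
     expanded the identity is rational in them. *)
  - rewrite !Rpower_1 in HS by assumption.
    rewrite !marg_1 in *.
    unfold Rdiv in *.
    repeat rewrite ln_mult in * by (repeat (apply Rmult_lt_0_compat || apply Rinv_0_lt_compat); assumption).
    rewrite !ln_Rinv in * by assumption.
    apply Rminus_le.
    match goal with |- ?x <= 0 => match type of Gr with _ <= ?gr =>
     match type of Gt with _ <= ?gt =>  match type of Gs with _ <= ?gs =>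
     replace x with (- gr - gt - gs) end end end end.
    + lra.
    + rewrite HS; field; nra.
Qed.

(** * Power means of nonpositive exponent *)

Lemma rpow_pos (x y : R) : 0 < x -> rpow x y = Rpower x y.
Proof. intros Hx; unfold rpow; destruct (Rle_dec x 0); [lra | reflexivity]. Qed.

Lemma rpow_1 (x : R) : 0 <= x -> rpow x 1 = x.
Proof.
  intros Hx; unfold rpow; destruct (Rle_dec x 0); [lra | apply Rpower_1; lra].
Qed.

Lemma power_mean_1 (r t : R) : 0 <= r -> 0 <= t -> power_mean 1 r t = (r + t) / 2.
Proof.
  intros Hr Ht; unfold power_mean.
  destruct (Req_EM_T 1 0); [lra |]; destruct (Rlt_dec 1 0); [lra |].
  replace (1 / 1) with 1 by field.
  now rewrite !rpow_1 by (rewrite ?rpow_1; lra).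
Qed.

Lemma power_mean_0 (r t : R) : power_mean 0 r t = sqrt (r * t).
Proof. unfold power_mean; destruct (Req_EM_T 0 0); [reflexivity | lra]. Qed.

Lemma power_mean_neg (q r t : R) : q < 0 -> 0 < r -> 0 < t ->
  power_mean q r t = Rpower ((Rpower r q + Rpower t q) / 2) (1 / q).
Proof.
  intros Hq Hr Ht; unfold power_mean.
  destruct (Req_EM_T q 0); [lra |]; destruct (Rlt_dec q 0); [| lra].
  destruct (Req_EM_T r 0); [lra |]; destruct (Req_EM_T t 0); [lra | reflexivity].
Qed.

Lemma power_mean_sym (q r t : R) : q <= 0 -> power_mean q r t = power_mean q t r.
Proof.
  intros Hq; unfold power_mean.
  destruct (Req_EM_T q 0); [now rewrite Rmult_comm |].
  destruct (Rlt_dec q 0); [| lra].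
  destruct (Req_EM_T r 0), (Req_EM_T t 0); try reflexivity.
  now rewrite Rplus_comm.
Qed.

Lemma power_mean_zero_l (q t : R) : q <= 0 -> power_mean q 0 t = 0.
Proof.
  intros Hq; unfold power_mean.
  destruct (Req_EM_T q 0); [rewrite Rmult_0_l; apply sqrt_0 |].
  destruct (Rlt_dec q 0); [| lra].
  destruct (Req_EM_T 0 0); [reflexivity | lra].
Qed.

Lemma power_mean_pos (q r t : R) : q <= 0 -> 0 < r -> 0 < t -> 0 < power_mean q r t.
Proof.
  intros [Hq | ->] Hr Ht.
  - rewrite power_mean_neg by assumption; apply Rpower_pos.
  - rewrite power_mean_0; apply sqrt_lt_R0; nra.
Qed.

Lemma Rpower_power_mean (q r t : R) : q < 0 -> 0 < r -> 0 < t ->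
  Rpower (power_mean q r t) q = (Rpower r q + Rpower t q) / 2.
Proof.
  intros Hq Hr Ht.
  assert (H1 := Rpower_pos r q); assert (H2 := Rpower_pos t q).
  rewrite power_mean_neg, Rpower_mult by assumption.
  replace (1 / q * q) with 1 by (field; lra).
  apply Rpower_1; lra.
Qed.

Lemma power_mean_diag (q r : R) : q <= 0 -> 0 <= r -> power_mean q r r = r.
Proof.
  intros Hq [Hr | <-]; [| now apply power_mean_zero_l].
  destruct Hq as [Hq | ->].
  - rewrite power_mean_neg by assumption.
    replace ((Rpower r q + Rpower r q) / 2) with (Rpower r q) by field.
    rewrite Rpower_mult.
    replace (q * (1 / q)) with 1 by (field; lra).
    now apply Rpower_1.
  - rewrite power_mean_0; apply sqrt_square; lra.
Qed.

(** For [q < 0], the arithmetic-geometric mean inequality for [r^q] and [t^q] compares the [q]-th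
    powers; since [q] is negative, undoing the power reverses the order. *)
Lemma power_mean_le_sqrt (q r t : R) :
  q <= 0 -> 0 <= r -> 0 <= t -> power_mean q r t <= sqrt (r * t).
Proof.
  intros Hq [Hr | <-] Ht; [| rewrite power_mean_zero_l by assumption; apply sqrt_pos].
  destruct Ht as [Ht | <-];
    [| rewrite power_mean_sym, power_mean_zero_l by assumption; apply sqrt_pos].
  destruct Hq as [Hq | ->]; [| rewrite power_mean_0; lra].
  assert (Hrt : 0 < r * t) by nra.
  assert (Hg : Rpower (sqrt (r * t)) q <= Rpower (power_mean q r t) q).
  { rewrite Rpower_power_mean, <- Rpower_sqrt, Rpower_mult, <- Rpower_mult_distr
      by assumption.
    replace q with (/ 2 * q + / 2 * q) at 3 4 by field.
    rewrite !Rpower_plus.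
    assert (H := pow2_ge_0 (Rpower r (/ 2 * q) - Rpower t (/ 2 * q))); nra. }
  assert (Hs : 0 < sqrt (r * t)) by now apply sqrt_lt_R0.
  assert (Hm := power_mean_pos q r t (Rlt_le _ _ Hq) Hr Ht).
  apply Rnot_lt_le; intros Hlt.
  assert (Hln := ln_increasing _ _ Hs Hlt).
  apply Rle_not_lt in Hg; apply Hg; apply exp_increasing; nra.
Qed.

(** * The distance factor of the coupling term *)

(** Splitting this factor off gives the cost one shape for [p = 1] and [p > 1]: masses minus mean
    times kernel. *)
Definition dist_kernel (p d : R) : R :=
  if Req_EM_T p 1 then exp (- d ^ 2 / 2)
  else rpow (pos_part (1 - (p - 1) * d ^ 2 / 2)) (p / (p - 1)).

Lemma dist_kernel_1 (d : R) : dist_kernel 1 d = exp (- d ^ 2 / 2).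
Proof. unfold dist_kernel; destruct (Req_EM_T 1 1); [reflexivity | lra]. Qed.

Lemma dist_kernel_gt1 (p d : R) : 1 < p -> 0 < 1 - (p - 1) * d ^ 2 / 2 ->
  dist_kernel p d = Rpower (1 - (p - 1) * d ^ 2 / 2) (p / (p - 1)).
Proof.
  intros Hp Hd; unfold dist_kernel, pos_part.
  destruct (Req_EM_T p 1); [lra |].
  rewrite Rmax_left by lra; now apply rpow_pos.
Qed.

Lemma dist_kernel_truncated (p d : R) : 1 < p -> 1 - (p - 1) * d ^ 2 / 2 <= 0 ->
  dist_kernel p d = 0.
Proof.
  intros Hp Hd; unfold dist_kernel, pos_part, rpow.
  destruct (Req_EM_T p 1); [lra |].
  rewrite Rmax_right by lra; destruct (Rle_dec 0 0); [reflexivity | lra].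
Qed.

Lemma dist_kernel_0 (p : R) : 1 <= p -> dist_kernel p 0 = 1.
Proof.
  intros [Hp | <-].
  - rewrite dist_kernel_gt1 by lra.
    replace (1 - (p - 1) * 0 ^ 2 / 2) with 1 by field.
    unfold Rpower; rewrite ln_1, Rmult_0_r; apply exp_0.
  - rewrite dist_kernel_1; replace (- 0 ^ 2 / 2) with 0 by field; apply exp_0.
Qed.

Lemma dist_kernel_nonneg (p d : R) : 1 <= p -> 0 <= dist_kernel p d.
Proof.
  intros [Hp | <-].
  - destruct (Rle_lt_dec (1 - (p - 1) * d ^ 2 / 2) 0).
    + rewrite dist_kernel_truncated by assumption; lra.
    + rewrite dist_kernel_gt1 by assumption; left; apply Rpower_pos.
  - rewrite dist_kernel_1; left; apply exp_pos.
Qed.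

Lemma dist_kernel_lt_1 (p d : R) : 1 <= p -> d <> 0 -> dist_kernel p d < 1.
Proof.
  intros Hp Hd.
  assert (Hd2 : 0 < d ^ 2) by (rewrite <- Rsqr_pow2; now apply Rsqr_pos_lt).
  destruct Hp as [Hp | <-].
  - destruct (Rle_lt_dec (1 - (p - 1) * d ^ 2 / 2) 0) as [Hy | Hy].
    + rewrite dist_kernel_truncated by assumption; lra.
    + rewrite dist_kernel_gt1 by assumption; unfold Rpower.
      apply Rlt_le_trans with (exp 0); [apply exp_increasing | rewrite exp_0; lra].
      assert (Hln : ln (1 - (p - 1) * d ^ 2 / 2) < 0)
        by (rewrite <- ln_1; apply ln_increasing; [assumption | nra]).
      assert (He : 0 < p / (p - 1)) by (apply Rdiv_lt_0_compat; lra).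
      nra.
  - rewrite dist_kernel_1, <- exp_0; apply exp_increasing; lra.
Qed.

Lemma dist_kernel_le_1 (p d : R) : 1 <= p -> dist_kernel p d <= 1.
Proof.
  intros Hp; destruct (Req_EM_T d 0) as [-> | Hd].
  - rewrite dist_kernel_0 by assumption; lra.
  - left; now apply dist_kernel_lt_1.
Qed.

(** * The rescaled cost: bounds and zeros *)

(** This is [p] times [Hp], with the distance as a bare real, so that the triangle inequality
    becomes a statement about numbers. *)
Definition cone_cost (p r t d : R) : R :=
  r + t - 2 * (power_mean (1 - p) r t * dist_kernel p d).

Lemma Hp_cone_cost (X : Type) (d : X -> X -> R) (p : R) (x y : X) (r t : R) :
  1 <= p -> 0 <= r -> 0 <= t -> Hp d p x r y t = cone_cost p r t (d x y) / p.
Proof.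
  intros Hp1 Hr Ht; unfold Hp, cone_cost, dist_kernel.
  rewrite power_mean_1 by assumption.
  destruct (Req_EM_T p 1) as [-> | Hne].
  - replace (1 - 1) with 0 by ring; field.
  - field; lra.
Qed.

Lemma cone_cost_sym (p r t d : R) : 1 <= p -> cone_cost p r t d = cone_cost p t r d.
Proof.
  intros Hp; unfold cone_cost; rewrite (power_mean_sym _ r t) by lra; ring.
Qed.

(** The kernel is at most [1] and the power mean at most the geometric mean, so the coupling term is
    at most [sqrt r * sqrt t]. *)
Lemma cone_cost_ge_hellinger (p r t d : R) : 1 <= p -> 0 <= r -> 0 <= t ->
  (sqrt r - sqrt t) ^ 2 <= cone_cost p r t d.
Proof.
  intros Hp Hr Ht; unfold cone_cost.
  assert (Hq : 1 - p <= 0) by lra.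
  assert (Hm := power_mean_le_sqrt _ r t Hq Hr Ht).
  rewrite sqrt_mult in Hm by assumption.
  assert (H0 := dist_kernel_nonneg p d Hp); assert (H1 := dist_kernel_le_1 p d Hp).
  assert (Hsr := sqrt_sqrt r Hr); assert (Hst := sqrt_sqrt t Ht).
  assert (Hprod : 0 <= sqrt r * sqrt t) by (apply Rmult_le_pos; apply sqrt_pos).
  nra.
Qed.

Lemma cone_cost_nonneg (p r t d : R) : 1 <= p -> 0 <= r -> 0 <= t ->
  0 <= cone_cost p r t d.
Proof.
  intros Hp Hr Ht.
  apply Rle_trans with (2 := cone_cost_ge_hellinger p r t d Hp Hr Ht), pow2_ge_0.
Qed.

Lemma power_mean_nonneg (q r t : R) : q <= 0 -> 0 <= r -> 0 <= t -> 0 <= power_mean q r t.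
Proof.
  intros Hq [Hr | <-] Ht; [| rewrite power_mean_zero_l; lra].
  destruct Ht as [Ht | <-]; [| rewrite power_mean_sym, power_mean_zero_l; lra].
  left; now apply power_mean_pos.
Qed.

Lemma cone_cost_le_sum (p r t d : R) : 1 <= p -> 0 <= r -> 0 <= t ->
  cone_cost p r t d <= r + t.
Proof.
  intros Hp Hr Ht; unfold cone_cost.
  assert (H := power_mean_nonneg (1 - p) r t ltac:(lra) Hr Ht).
  assert (H0 := dist_kernel_nonneg p d Hp); nra.
Qed.

(** The Hellinger bound forces [r = t]; on the diagonal the cost is [2 * r * (1 - dist_kernel p d)],
    and the kernel equals [1] only at distance [0]. *)
Lemma cone_cost_eq_0 (p r t d : R) : 1 <= p -> 0 <= r -> 0 <= t ->
  (cone_cost p r t d = 0 <-> (r = 0 /\ t = 0) \/ (r = t /\ d = 0)).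
Proof.
  intros Hp Hr Ht; split.
  - intros H0.
    assert (H := cone_cost_ge_hellinger p r t d Hp Hr Ht).
    assert (Hrt : r = t) by (apply sqrt_inj; [assumption | assumption | nra]).
    subst t; destruct (Req_EM_T r 0) as [-> | Hr0]; [tauto |].
    right; split; [reflexivity |].
    destruct (Req_EM_T d 0) as [Hd | Hd]; [assumption | exfalso].
    assert (Hk := dist_kernel_lt_1 p d Hp Hd).
    unfold cone_cost in H0; rewrite power_mean_diag in H0 by lra; nra.
  - unfold cone_cost; intros [[-> ->] | [-> ->]].
    + rewrite power_mean_zero_l; lra.
    + rewrite dist_kernel_0, power_mean_diag; lra.
Qed.

(** * The cost as a minimum over [th] *)

(** This is where the exponent [1 - p] of the mean comes from: the two masses enter only through
    their sum and [r^(1-p) + t^(1-p)]. *)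
Lemma marg_sum_gt1 (p r t d th : R) : 1 < p -> 0 < r -> 0 < t ->
  marg p r th + marg p t th + p * th * d ^ 2
  = r + t - 2 * ((p * th * (1 - (p - 1) * d ^ 2 / 2)
                  - Rpower th p * Rpower (power_mean (1 - p) r t) (1 - p)) / (p - 1)).
Proof.
  intros Hp Hr Ht.
  rewrite !marg_gt1, Rpower_power_mean by lra; field; lra.
Qed.

(** With [y] the base of the kernel, [Y = y^(1/(p-1))] solves the stationarity equation
    [Y^(p-1) = y]; the minimizing [th] is then [M * Y], with [M] the power mean of the masses. *)
Lemma dist_kernel_untruncated (p d : R) : 1 < p -> 0 < 1 - (p - 1) * d ^ 2 / 2 ->
  exists Y, 0 < Y /\ Rpower Y p = (1 - (p - 1) * d ^ 2 / 2) * Y /\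
    dist_kernel p d = (1 - (p - 1) * d ^ 2 / 2) * Y.
Proof.
  intros Hp Hy; rewrite dist_kernel_gt1 by assumption.
  set (y := 1 - (p - 1) * d ^ 2 / 2) in *.
  exists (Rpower y (1 / (p - 1))).
  assert (H : Rpower y (p / (p - 1)) = y * Rpower y (1 / (p - 1))).
  { replace (p / (p - 1)) with (1 + 1 / (p - 1)) by (field; lra).
    now rewrite Rpower_plus, Rpower_1. }
  split; [apply Rpower_pos | split; [| assumption]].
  rewrite Rpower_mult, <- H; f_equal; field; lra.
Qed.

(** For [p = 1] the two entropies and the distance term combine into a single entropy relative to
    [th0], which is therefore the minimizer. *)
Lemma marg_sum_1 (r t d th : R) : 0 < r -> 0 < t -> 0 < th ->
  let th0 := power_mean 0 r t * dist_kernel 1 d in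
  0 < th0 /\
  marg 1 r th + marg 1 t th + 1 * th * d ^ 2
  = r + t - 2 * th + 2 * (th * ln (th / th0)).
Proof.
  intros Hr Ht Hth th0.
  assert (Hm := power_mean_pos 0 r t (Rle_refl 0) Hr Ht).
  assert (Hrt : 0 < r * t) by nra.
  assert (Hth0 : 0 < th0)
    by (unfold th0; rewrite dist_kernel_1; apply Rmult_lt_0_compat;
        [assumption | apply exp_pos]).
  split; [assumption |].
  assert (Hln : ln th0 = (ln r + ln t - d ^ 2) / 2).
  { unfold th0; rewrite dist_kernel_1, ln_mult, ln_exp by (assumption || apply exp_pos).
    rewrite power_mean_0, <- Rpower_sqrt, ln_Rpower, ln_mult by assumption; field. }
  rewrite !marg_1; unfold Rdiv.
  rewrite !ln_mult, !ln_Rinv by (try apply Rinv_0_lt_compat; assumption).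
  rewrite Hln; field.
Qed.

Lemma cone_cost_le_variational (p r t d th : R) :
  1 <= p -> 0 < r -> 0 < t -> 0 < th ->
  cone_cost p r t d <= marg p r th + marg p t th + p * th * d ^ 2.
Proof.
  intros Hp Hr Ht Hth; unfold cone_cost; destruct Hp as [Hp | <-].
  - rewrite marg_sum_gt1 by assumption.
    assert (HM := power_mean_pos (1 - p) r t ltac:(lra) Hr Ht).
    set (M := power_mean (1 - p) r t) in *.
    assert (Hthp := Rpower_pos th p); assert (HMq := Rpower_pos M (1 - p)).
    apply Rplus_le_compat_l, Ropp_le_contravar, Rmult_le_compat_l; [lra |].
    apply Rmult_le_reg_r with (p - 1); [lra |].
    unfold Rdiv at 1; rewrite Rmult_assoc, Rinv_l, Rmult_1_r by lra.
    assert (Hprod : 0 < Rpower th p * Rpower M (1 - p)) by nra.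
    (* When the base is nonpositive, the bracket subtracted in the sum is negative while the
       coupling is [0]. Otherwise the power of [th] is bounded below by its tangent at the minimizer
       [M * Y]. *)
    destruct (Rle_lt_dec (1 - (p - 1) * d ^ 2 / 2) 0) as [Hy | Hy].
    + rewrite dist_kernel_truncated by assumption.
      assert (0 < p * th) by nra; nra.
    + destruct (dist_kernel_untruncated p d Hp Hy) as (Y & HY & HYp & ->).
      set (y := 1 - (p - 1) * d ^ 2 / 2) in *.
      assert (HMY : 0 < M * Y) by nra.
      assert (HT := Rpower_tangent th (M * Y) p (Rlt_le _ _ Hp) Hth HMY).
      apply (Rmult_le_compat_r (Rpower M (1 - p))) in HT; [| lra].
      rewrite <- Rpower_mult_distr, HYp in HT by assumption.
      replace (Rpower M p * (y * Y) * (1 + p * (th / (M * Y) - 1)) * Rpower M (1 - p))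
        with (Rpower M p * Rpower M (1 - p) * (y * Y) * (1 + p * (th / (M * Y) - 1)))
        in HT by ring.
      rewrite Rpower_split in HT by assumption.
      replace (M * (y * Y) * (1 + p * (th / (M * Y) - 1)))
        with (M * (y * Y) * (1 - p) + p * th * y) in HT by (field; lra).
      lra.
  - destruct (marg_sum_1 r t d th Hr Ht Hth) as [Hth0 ->].
    replace (1 - 1) with 0 by ring.
    assert (H := ln_div_lower th _ Hth Hth0); lra.
Qed.

(** A nonzero kernel excludes the truncated range, where the infimum is approached only as [th]
    tends to [0]. Otherwise the stationary point is the witness. *)
Lemma cone_cost_variational_attained (p r t d : R) :
  1 <= p -> 0 < r -> 0 < t -> dist_kernel p d <> 0 ->
  exists th, 0 < th /\
    marg p r th + marg p t th + p * th * d ^ 2 = cone_cost p r t d.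
Proof.
  intros Hp Hr Ht Hk; unfold cone_cost; destruct Hp as [Hp | <-].
  - assert (HM := power_mean_pos (1 - p) r t ltac:(lra) Hr Ht).
    destruct (Rle_lt_dec (1 - (p - 1) * d ^ 2 / 2) 0) as [Hy | Hy];
      [now rewrite dist_kernel_truncated in Hk by assumption |].
    destruct (dist_kernel_untruncated p d Hp Hy) as (Y & HY & HYp & ->).
    exists (power_mean (1 - p) r t * Y); split; [nra |].
    rewrite marg_sum_gt1 by assumption.
    set (M := power_mean (1 - p) r t) in *.
    set (y := 1 - (p - 1) * d ^ 2 / 2) in *.
    rewrite <- Rpower_mult_distr, HYp by assumption.
    replace (Rpower M p * (y * Y) * Rpower M (1 - p))
      with (Rpower M p * Rpower M (1 - p) * (y * Y)) by ring.
    rewrite Rpower_split by assumption; field; lra.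
  - exists (power_mean 0 r t * dist_kernel 1 d).
    assert (Hth0 : 0 < power_mean 0 r t * dist_kernel 1 d)
      (* Only the positivity of the minimizer is extracted here; the value [1] for [th] is
         arbitrary. *)
      by (apply (marg_sum_1 r t d 1); lra).
    split; [assumption |].
    destruct (marg_sum_1 r t d _ Hr Ht Hth0) as [_ ->].
    replace (1 - 1) with 0 by ring.
    unfold Rdiv; rewrite Rinv_r, ln_1 by lra; ring.
Qed.

(** * From weighted inequalities to the triangle inequality *)

(* [sqrt A <= sqrt B + sqrt C] iff [A <= B / l + C / (1 - l)] for every weight [l];
   the optimal [l] is [sqrt B / (sqrt B + sqrt C)]. *)
Lemma sqrt_triangle_of_weighted (A B C : R) :
  0 <= A -> 0 <= B -> 0 <= C ->
  (forall l, 0 < l < 1 -> l * (1 - l) * A <= (1 - l) * B + l * C) ->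
  sqrt A <= sqrt B + sqrt C.
Proof.
  intros HA HB HC H.
  assert (Hsb := sqrt_pos B); assert (Hsc := sqrt_pos C).
  assert (Hb := sqrt_sqrt B HB); assert (Hc := sqrt_sqrt C HC).
  assert (Hsq : A <= (sqrt B + sqrt C) * (sqrt B + sqrt C)).
  { destruct (Req_EM_T B 0) as [-> | HB0].
    { rewrite sqrt_0, Rplus_0_l, Hc.
      apply Rnot_lt_le; intros Hlt.
      (* For [B = 0] the optimal weight degenerates to [0]. This [l] makes [(1 - l) * A] the
         midpoint of [A] and [C], which exceeds [C] and contradicts the hypothesis. *)
      set (l := (A - C) / (2 * A)).
      assert (HlA : l * A = (A - C) / 2) by (unfold l; field; lra).
      assert (Hl : 0 < l < 1) by nra.
      assert (Hw := H l Hl); nra. }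
    destruct (Req_EM_T C 0) as [-> | HC0].
    { rewrite sqrt_0, Rplus_0_r, Hb.
      apply Rnot_lt_le; intros Hlt.
      (* Symmetrically, the optimal weight degenerates to [1], and here [l * A] is the midpoint of
         [A] and [B]. *)
      set (l := (A + B) / (2 * A)).
      assert (HlA : l * A = (A + B) / 2) by (unfold l; field; lra).
      assert (Hl : 0 < l < 1) by nra.
      assert (Hw := H l Hl); nra. }
    assert (0 < sqrt B) by (apply sqrt_lt_R0; lra).
    assert (0 < sqrt C) by (apply sqrt_lt_R0; lra).
    set (l := sqrt B / (sqrt B + sqrt C)).
    assert (Hl : 0 < l < 1).
    { unfold l; split; [apply Rdiv_lt_0_compat; lra |].
      apply Rmult_lt_reg_r with (sqrt B + sqrt C); [lra |].
      unfold Rdiv; rewrite Rmult_assoc, Rinv_l; lra. }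
    assert (Hw := H l Hl).
    assert (Hl1 : l * (sqrt B + sqrt C) = sqrt B) by (unfold l; field; lra).
    apply Rmult_le_reg_l with (sqrt B * sqrt C); [nra |].
    replace (sqrt B * sqrt C * A)
      with (l * (1 - l) * A * ((sqrt B + sqrt C) * (sqrt B + sqrt C)))
      by (unfold l; field; lra).
    replace (sqrt B * sqrt C * ((sqrt B + sqrt C) * (sqrt B + sqrt C)))
      with (((1 - l) * (sqrt B * sqrt B) + l * (sqrt C * sqrt C))
            * ((sqrt B + sqrt C) * (sqrt B + sqrt C))) by (unfold l; field; lra).
    rewrite Hb, Hc.
    apply Rmult_le_compat_r; [nra | assumption]. }
  rewrite <- (sqrt_square (sqrt B + sqrt C)) by lra.
  now apply sqrt_le_1_alt.
Qed.

(** The first leg costs [r + s] and the left side at most [r + t]. What remains is the planar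
    triangle inequality for the vectors [(sqrt r, sqrt s)] and [(sqrt r, sqrt t)], whose difference
    has length at most the Hellinger bound for the second leg. *)
Lemma cone_cost_triangle_decoupled (p r s t d12 d23 d13 : R) :
  1 <= p -> 0 <= r -> 0 <= s -> 0 <= t ->
  power_mean (1 - p) r s * dist_kernel p d12 = 0 ->
  sqrt (cone_cost p r t d13) <= sqrt (cone_cost p r s d12) + sqrt (cone_cost p s t d23).
Proof.
  intros Hp Hr Hs Ht H0.
  assert (E12 : cone_cost p r s d12 = r + s) by (unfold cone_cost; rewrite H0; ring).
  rewrite E12.
  apply Rle_trans with (sqrt (r + t)).
  { apply sqrt_le_1_alt, cone_cost_le_sum; assumption. }
  assert (H23 := cone_cost_ge_hellinger p s t d23 Hp Hs Ht).
  apply sqrt_le_1_alt in H23.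
  rewrite <- Rsqr_pow2, sqrt_Rsqr_abs in H23.
  apply Rle_trans with (sqrt (r + s) + Rabs (sqrt s - sqrt t)); [| lra].
  assert (Ha := sqrt_pos s); assert (Hb := sqrt_pos t).
  assert (Ha2 := sqrt_sqrt s Hs); assert (Hb2 := sqrt_sqrt t Ht).
  assert (HA := sqrt_pos (r + s)); assert (HA2 := sqrt_sqrt (r + s) ltac:(lra)).
  assert (HaA : sqrt s <= sqrt (r + s)) by (apply sqrt_le_1_alt; lra).
  assert (Habs := Rabs_pos (sqrt s - sqrt t)).
  rewrite <- (sqrt_square (sqrt (r + s) + Rabs (sqrt s - sqrt t))) by lra.
  apply sqrt_le_1_alt.
  destruct (Rle_dec (sqrt t) (sqrt s)).
  - nra.
  - rewrite Rabs_left in * by lra; nra.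
Qed.

Lemma cone_cost_triangle_coupled (p r s t d12 d23 d13 : R) :
  1 <= p -> 0 < r -> 0 < s -> 0 < t ->
  dist_kernel p d12 <> 0 -> dist_kernel p d23 <> 0 -> 0 <= d13 <= d12 + d23 ->
  sqrt (cone_cost p r t d13) <= sqrt (cone_cost p r s d12) + sqrt (cone_cost p s t d23).
Proof.
  intros Hp Hr Hs Ht Hk1 Hk2 Hd.
  apply sqrt_triangle_of_weighted; try (apply cone_cost_nonneg; lra).
  intros l Hl.
  destruct (cone_cost_variational_attained p r s d12 Hp Hr Hs Hk1) as (th1 & H1 & <-).
  destruct (cone_cost_variational_attained p s t d23 Hp Hs Ht Hk2) as (th2 & H2 & <-).
  destruct (marg_merge p l r s t th1 th2 Hp Hl Hr Hs Ht H1 H2) as (th & Hth & Hmean & HG).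
  assert (Hup := cone_cost_le_variational p r t d13 th Hp Hr Ht Hth).
  apply (Rmult_le_compat_l (l * (1 - l))) in Hup; [| nra].
  assert (Hdist : l * (1 - l) * (th * d13 ^ 2)
                  <= (1 - l) * (th1 * d12 ^ 2) + l * (th2 * d23 ^ 2)).
  (* Cauchy-Schwarz in the form [a * b * (x + y)^2 <= (a + b) * (a * x^2 + b * y^2)], whose defect
     is [(a * x - b * y)^2]. The bound on [th * (a + b)] from the merging step supplies the left
     side. *)
  { set (a := (1 - l) * th1) in *; set (b := l * th2) in *.
    assert (Ha : 0 < a) by (unfold a; nra); assert (Hb : 0 < b) by (unfold b; nra).
    apply Rmult_le_reg_l with (a + b); [lra |].
    apply Rle_trans with (a * b * (d12 + d23) ^ 2).
    - replace ((a + b) * (l * (1 - l) * (th * d13 ^ 2)))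
        with (l * (1 - l) * (th * (a + b)) * d13 ^ 2) by ring.
      replace (a * b) with (l * (1 - l) * (th1 * th2)) by (unfold a, b; ring).
      apply Rmult_le_compat.
      + repeat apply Rmult_le_pos; lra.
      + apply pow2_ge_0.
      + apply Rmult_le_compat_l; [nra | assumption].
      + apply pow_incr; assumption.
    - assert (Hsq := pow2_ge_0 (a * d12 - b * d23)).
      replace ((1 - l) * (th1 * d12 ^ 2)) with (a * d12 ^ 2) by (unfold a; ring).
      replace (l * (th2 * d23 ^ 2)) with (b * d23 ^ 2) by (unfold b; ring).
      lra. }
  apply (Rmult_le_compat_l p) in Hdist; lra.
Qed.

Lemma cone_cost_triangle (p r s t d12 d23 d13 : R) :
  1 <= p -> 0 <= r -> 0 <= s -> 0 <= t -> 0 <= d13 <= d12 + d23 ->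
  sqrt (cone_cost p r t d13) <= sqrt (cone_cost p r s d12) + sqrt (cone_cost p s t d23).
Proof.
  intros Hp Hr Hs Ht Hd.
  destruct (Req_EM_T (power_mean (1 - p) r s * dist_kernel p d12) 0) as [H12 | H12];
    [now apply cone_cost_triangle_decoupled |].
  (* The masses are taken in the order [t], [s], so that the decoupled case applies to the path
     traversed backwards. *)
  destruct (Req_EM_T (power_mean (1 - p) t s * dist_kernel p d23) 0) as [H23 | H23].
  { rewrite (cone_cost_sym p r t), (cone_cost_sym p r s), (cone_cost_sym p s t),
      Rplus_comm by assumption.
    now apply cone_cost_triangle_decoupled. }
  assert (Hq : 1 - p <= 0) by lra.
  (* Two nonzero coupling terms force all three masses to be positive and both kernels to be
     nonzero. *)
  destruct Hr as [Hr | <-]; [| now rewrite power_mean_zero_l, Rmult_0_l in H12].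
  destruct Ht as [Ht | <-]; [| now rewrite power_mean_zero_l, Rmult_0_l in H23].
  destruct Hs as [Hs | <-];
    [| now rewrite power_mean_sym, power_mean_zero_l, Rmult_0_l in H12].
  apply cone_cost_triangle_coupled; try assumption;
    intros Hk; rewrite Hk, Rmult_0_r in *; tauto.
Qed.

(** * The metric axioms on the cone *)

Theorem mainTheorem14 (X : Type) (d : X -> X -> R) (p : R)
  (hd : is_metric d) (hp : 1 <= p) :
  (* well defined on the cone *)
  (forall (x1 x1' x2 x2' : X) (r r' t t' : R),
     0 <= r -> 0 <= r' -> 0 <= t -> 0 <= t' ->
     cone_eq x1 r x1' r' -> cone_eq x2 t x2' t' ->
     Hp d p x1 r x2 t = Hp d p x1' r' x2' t') /\
  (* nonnegative *)
  (forall (x1 x2 : X) (r t : R), 0 <= r -> 0 <= t -> 0 <= Hp d p x1 r x2 t) /\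
  (* vanishes iff the classes coincide *)
  (forall (x1 x2 : X) (r t : R), 0 <= r -> 0 <= t ->
     (Hp d p x1 r x2 t = 0 <-> cone_eq x1 r x2 t)) /\
  (* symmetric *)
  (forall (x1 x2 : X) (r t : R), 0 <= r -> 0 <= t ->
     Hp d p x1 r x2 t = Hp d p x2 t x1 r) /\
  (* triangle inequality for sqrt H_p *)
  (forall (x1 x2 x3 : X) (r s t : R), 0 <= r -> 0 <= s -> 0 <= t ->
     sqrt (Hp d p x1 r x3 t) <= sqrt (Hp d p x1 r x2 s) + sqrt (Hp d p x2 s x3 t)).
Proof.
  destruct hd as (d_nonneg & d_0 & d_sym & d_triangle).
  split; [| split; [| split; [| split]]].
  - intros x1 x1' x2 x2' r r' t t' Hr Hr' Ht Ht' H1 H2.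
    rewrite !Hp_cone_cost by assumption; unfold cone_cost.
    destruct H1 as [[-> ->] | [-> ->]].
    (* At the apex the mean vanishes, and the base points drop out with the coupling term. *)
    + rewrite !power_mean_zero_l by lra.
      destruct H2 as [[-> ->] | [-> ->]]; field; lra.
    + destruct H2 as [[-> ->] | [-> ->]]; [| reflexivity].
      rewrite !(power_mean_sym _ r' 0), !power_mean_zero_l by lra; field; lra.
  - intros x1 x2 r t Hr Ht; rewrite Hp_cone_cost by assumption.
    apply Rmult_le_pos; [now apply cone_cost_nonneg |].
    left; apply Rinv_0_lt_compat; lra.
  - intros x1 x2 r t Hr Ht; rewrite Hp_cone_cost by assumption.
    unfold cone_eq; rewrite <- d_0, <- (cone_cost_eq_0 p) by assumption.
    split; intros H0; [| rewrite H0; field; lra].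
    replace (cone_cost p r t (d x1 x2)) with (cone_cost p r t (d x1 x2) / p * p)
      by (field; lra).
    rewrite H0; ring.
  - intros x1 x2 r t Hr Ht; rewrite !Hp_cone_cost, d_sym by assumption.
    now rewrite cone_cost_sym.
  - intros x1 x2 x3 r s t Hr Hs Ht; rewrite !Hp_cone_cost by assumption.
    rewrite !sqrt_div_alt by lra.
    rewrite <- Rdiv_plus_distr.
    apply Rmult_le_compat_r; [left; apply Rinv_0_lt_compat, sqrt_lt_R0; lra |].
    apply cone_cost_triangle; try assumption; auto.
Qed.
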